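(* Let $(D,S,t_{\max})$ and $(D',S',t'_{\max})$ both satisfy the standing assumptions below with the same (known) initial moment $t_{\min}$, and let $w^\infty$, $w'^\infty$ be their far-field patterns. Fix $\hat x\in\mathbb S^2$ and $0\le k_{\min}<k_{\max}$. If $w^\infty(\hat x,k)=w'^\infty(\hat x,k)$ and $w^\infty(-\hat x,k)=w'^\infty(-\hat x,k)$ for all $k\in(k_{\min},k_{\max})$, then $K_D^{(\hat x)}=K_{D'}^{(\hat x)}$ and $t_{\max}=t'_{\max}$.
   Context: Standing assumptions on a triple $(D,S,t_{\max})$: $D\subset\mathbb R^3$ is a bounded Lipschitz domain (open, connected) with $\mathbb R^3\setminus\overline D$ connected; $0\le t_{\min}<t_{\max}$; $S\in C([t_{\min},t_{\max}];L^\infty(D))$ is real-valued with $S\ge c_0>0$ a.e. on $D\times[t_{\min},t_{\max}]$ for some $c_0>0$. The far-field pattern is $w^\infty(\hat x,k)=\frac{1}{\sqrt{2\pi}}\int_{t_{\min}}^{t_{\max}}\int_D e^{{\rm i}k(t-\hat x\cdot y)}S(y,t)\,dy\,dt$ for $\hat x\in\mathbb S^2$, $k\in\mathbb R$. With $\hat x\cdot D=\{\hat x\cdot y:y\in D\}$, $K_D^{(\hat x)}=\{y\in\mathbb R^3:\inf(\hat x\cdot D)<\hat x\cdot y<\sup(\hat x\cdot D)\}$. *)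

(* Defs.v *)
From mathcomp Require Import all_boot all_order all_algebra.
From mathcomp Require Import all_classical all_reals all_analysis.
From mathcomp Require Import complex.
Set Warnings "-notation-overridden".
Import numFieldNormedType.Exports.
Import Order.TTheory GRing.Theory Num.Theory.
Local Open Scope classical_set_scope.
Local Open Scope ring_scope.

Set Implicit Arguments.
Unset Strict Implicit.
Unset Printing Implicit Defensive.

(* Points of R^3 are triples ((y1, y2), y3), with the product topology
   and the product (Borel) sigma-algebra. *)
Notation pt R := (R * R * R)%type.

Definition dot (R : realType) (x y : pt R) : R :=
  x.1.1 * y.1.1 + x.1.2 * y.1.2 + x.2 * y.2.

Definition vsub (R : realType) (x y : pt R) : pt R :=
  (x.1.1 - y.1.1, x.1.2 - y.1.2, x.2 - y.2).

Definition vopp (R : realType) (x : pt R) : pt R :=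
  (- x.1.1, - x.1.2, - x.2).

Definition on_sphere2 (R : realType) (x : pt R) : Prop := dot x x = 1.

Definition leb3 (R : realType) :=
  product_measure1 (product_measure1 (@lebesgue_measure R) (@lebesgue_measure R))
                   (@lebesgue_measure R).

Definition bounded3 (R : realType) (D : set (pt R)) : Prop :=
  exists M : R, forall y, D y -> `|y.1.1| <= M /\ `|y.1.2| <= M /\ `|y.2| <= M.

Definition lipschitz2 (R : realType) (g : R -> R -> R) : Prop :=
  exists L : R, forall a b a' b' : R,
    `|g a b - g a' b'| <= L * Num.sqrt ((a - a') ^+ 2 + (b - b') ^+ 2).

(* Lipschitz domain (local-graph definition): near every boundary point p,
   after an orthogonal change of coordinates Q centred at p, D coincides
   (inside an open neighbourhood V of p) with the region below the graph of
   a Lipschitz function of the first two coordinates. *)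
Definition lipschitz_domain (R : realType) (D : set (pt R)) : Prop :=
  forall p : pt R, closure D p -> ~ D p ->
    exists (V : set (pt R)) (Q : pt R -> pt R) (g : R -> R -> R),
      [/\ open V, V p,
          (forall u v, dot (Q u) (Q v) = dot u v),
          lipschitz2 g &
          forall y, V y ->
            (D y <-> (Q (vsub y p)).2 < g (Q (vsub y p)).1.1 (Q (vsub y p)).1.2)].

(* The standing assumptions on a triple (D, S, t_max) with initial moment
   t_min.  S y t is the value of the source at the point y and time t;
   S : [t_min, t_max] -> L^oo(D) is continuous, real-valued, and
   S >= c0 > 0 a.e. *)
Definition standing (R : realType) (D : set (pt R)) (S : pt R -> R -> R)
    (tmin tmax : R) : Prop :=
  D !=set0 /\ open D /\ connected D /\ bounded3 D /\
      lipschitz_domain D /\ connected (~` closure D) /\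
      (0 <= tmin /\ tmin < tmax) /\
      (forall t, tmin <= t <= tmax ->
         measurable_fun D (fun y => S y t) /\
         exists M : R, {ae @leb3 R, forall y, D y -> `|S y t| <= M}) /\
      (forall t0, tmin <= t0 <= tmax -> forall eps : R, 0 < eps ->
         exists2 delta : R, 0 < delta &
           forall t, tmin <= t <= tmax -> `|t - t0| < delta ->
             {ae @leb3 R, forall y, D y -> `|S y t - S y t0| <= eps}) /\
      (exists2 c0 : R, 0 < c0 &
        forall t, tmin <= t <= tmax ->
          {ae @leb3 R, forall y, D y -> c0 <= S y t}).

(* far-field pattern
   w^oo(xh, k) = (2 pi)^(-1/2) int_tmin^tmax int_D e^{i k (t - xh.y)} S(y,t) dy dt,
   written through its real and imaginary parts. *)
Definition farfield (R : realType) (D : set (pt R)) (S : pt R -> R -> R)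
    (tmin tmax : R) (xh : pt R) (k : R) : R[i] :=
  let re := Rintegral (@lebesgue_measure R) `[tmin, tmax]
     (fun t => Rintegral (@leb3 R) D (fun y => cos (k * (t - dot xh y)) * S y t)) in
  let im := Rintegral (@lebesgue_measure R) `[tmin, tmax]
     (fun t => Rintegral (@leb3 R) D (fun y => sin (k * (t - dot xh y)) * S y t)) in
  Complex (re / Num.sqrt (2 * pi)) (im / Num.sqrt (2 * pi)).

Definition Kslab (R : realType) (D : set (pt R)) (xh : pt R) : set (pt R) :=
  [set y | inf [set dot xh z | z in D] < dot xh y < sup [set dot xh z | z in D]].

(* Main.v *)
(** For fixed [xh], the map [f |-> L f = int_tmin^tmax int_D f (t - xh.y) S(y,t) dy dt]
    is integration against a positive compactly supported measure on the line,
    and the far field is its Fourier transform.  Equality of the far fields for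
    [k] in an interval gives, by differentiating in [k], equality of
    [L (s^n cos (k s))] and [L (s^n sin (k s))] for all [n]; since
    [s^n = s^n (cos^2 (k s) + sin^2 (k s))] and one factor [cos] or [sin] can be
    approximated uniformly by polynomials, all moments [L (s^n)] agree.  The growth
    of the moments of [s + M] and [M - s] then determines the end points
    [tmin - sup (xh.D)] and [tmax - inf (xh.D)] of the support.  The direction
    [-xh] yields [tmin + inf (xh.D)], and the three numbers determine the slab
    and [tmax]. *)

Require Import Defs.
From mathcomp Require Import all_boot all_order all_algebra.
From mathcomp Require Import all_classical all_reals all_analysis.
From mathcomp Require Import complex.
From mathcomp Require Import measurable_realfun ring lra.
Import numFieldNormedType.Exports.
Import Order.TTheory GRing.Theory Num.Theory.
Local Open Scope classical_set_scope.
Local Open Scope ring_scope.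

Set Implicit Arguments.
Unset Strict Implicit.
Unset Printing Implicit Defensive.

(** * Trigonometric moments *)

Section taylor.
Variable R : realType.
Implicit Types (f df : R -> R) (a b x X : R).

(** The increments [h * s] used later have no fixed sign, so both orders of [x] and [y] are covered
    at once. *)
Lemma mean_value f df x y : (forall z : R, is_derive z (1 : R) f (df z)) ->
  exists2 c, `|c - x| <= `|y - x| & f y - f x = df c * (y - x).
Proof.
move=> fdf.
have cf : continuous f.
  by move=> z; apply: differentiable_continuous; apply/derivable1_diffP; have [] := fdf z.
have [xy|yx|->] := ltgtP x y.
- have [c /itvP cxy E] := MVT xy (fun z _ => fdf z) (continuous_subspaceT cf).
  exists c => //.
  by rewrite !ger0_norm ?subr_ge0 ?lerD2r ?cxy// ltW.
- have [c /itvP cxy E] := MVT yx (fun z _ => fdf z) (continuous_subspaceT cf).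
  exists c; last by rewrite -opprB E -mulrN opprB.
  by rewrite !ler0_norm ?subr_le0 ?lerN2 ?lerD2r ?cxy// ltW.
- by exists y; rewrite ?subrr ?mulr0.
Qed.

Lemma lipschitz1_derive f df : (forall z : R, is_derive z (1 : R) f (df z)) ->
  (forall z, `|df z| <= 1) -> forall x y, `|f y - f x| <= `|y - x|.
Proof.
move=> fdf df1 x y; have [c _ ->] := mean_value x y fdf.
by rewrite normrM ler_piMl.
Qed.

(** The mean value theorem gives [b * df c] with [c] within [|b|] of [a]; the Lipschitz bound on
    [df] contributes a second factor [|b|]. *)
Lemma first_order_bound f df : (forall z : R, is_derive z (1 : R) f (df z)) ->
  (forall x y, `|df y - df x| <= `|y - x|) ->
  forall a b, `|f (a + b) - f a - b * df a| <= b ^+ 2.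
Proof.
move=> fdf ldf a b; have [c ca ->] := mean_value a (a + b) fdf.
rewrite addrAC subrr add0r in ca *.
rewrite mulrC -mulrBr normrM -real_normK ?num_real// expr2.
by rewrite ler_wpM2l// (le_trans (ldf _ _)).
Qed.

Lemma cos_first_order a b : `|cos (a + b) - cos a - b * - sin a| <= b ^+ 2 :> R.
Proof.
apply: (@first_order_bound cos (fun x => - sin x)) => x y.
rewrite -opprD normrN.
exact: (lipschitz1_derive (df := cos) _ (@cos_max R)).
Qed.

Lemma sin_first_order a b : `|sin (a + b) - sin a - b * cos a| <= b ^+ 2 :> R.
Proof.
apply: (@first_order_bound sin cos) => x y.
apply: (lipschitz1_derive (df := fun x => - sin x)) => z.
by rewrite normrN sin_max.
Qed.

(** The coefficients are dominated by those of the exponential series, whose tail at [X] bounds the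
    error uniformly on [|x| <= X]; a partial sum is then the polynomial. *)
Lemma power_series_approx (c : R^nat) f X :
  (forall i, `|c i| <= i`!%:R^-1) ->
  (forall x, series (fun i => c i * x ^+ i) @ \oo --> f x) ->
  forall eps, 0 < eps ->
  exists p : {poly R}, forall x, `|x| <= X -> `|f x - p.[x]| <= eps.
Proof.
move=> cle fE eps eps0.
have /cvgrPdist_le /(_ _ eps0) [N _ NE] := is_cvg_series_exp_coeff X.
exists (\poly_(i < N) c i) => x xX.
have X0 : 0 <= X by rewrite (le_trans _ xX).
have -> : (\poly_(i < N) c i).[x] = series (fun i => c i * x ^+ i) N.
  by rewrite horner_poly /series /= big_mkord.
have {}NE : limn (series (exp_coeff X)) - series (exp_coeff X) N <= eps.
  by rewrite (le_trans (ler_norm _))// NE /=.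
apply: le_trans NE.
(* The comparison is made on finite blocks from [N] to [n] and then passed to the limit in [n]. *)
have h1 : `|series (fun i => c i * x ^+ i) n - series (fun i => c i * x ^+ i) N|
    @[n --> \oo] --> `|f x - series (fun i => c i * x ^+ i) N|.
  by apply: cvg_norm; apply: cvgB; [exact: fE|exact: cvg_cst].
have h2 : series (exp_coeff X) n - series (exp_coeff X) N @[n --> \oo]
    --> limn (series (exp_coeff X)) - series (exp_coeff X) N.
  by apply: cvgB; [exact: is_cvg_series_exp_coeff|exact: cvg_cst].
apply: (ler_cvg_to h1 h2); exists N => // n /= Nn.
rewrite !sub_series_geq// (le_trans (ler_norm_sum _ _ _))// ler_sum// => i _.
rewrite normrM normrX /exp_coeff /= mulrC ler_pM//.
by rewrite lerXn2r// nnegrE.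
Qed.

Lemma cos_poly_approx X eps : 0 < eps ->
  exists p : {poly R}, forall x, `|x| <= X -> `|cos x - p.[x]| <= eps.
Proof.
apply: (@power_series_approx (fun i => (~~ odd i)%:R * (-1) ^+ i./2 * i`!%:R^-1)).
  move=> i; rewrite !normrM normrX normrN1 expr1n mulr1 normfV !normr_nat.
  by rewrite ler_piMl ?invr_ge0//; case: odd.
by move=> x; have := @is_cvg_series_cos_coeff R x; rewrite cosE cos_coeffE.
Qed.

Lemma sin_poly_approx X eps : 0 < eps ->
  exists p : {poly R}, forall x, `|x| <= X -> `|sin x - p.[x]| <= eps.
Proof.
apply: (@power_series_approx (fun i => (odd i)%:R * (-1) ^+ i.-1./2 * i`!%:R^-1)).
  move=> i; rewrite !normrM normrX normrN1 expr1n mulr1 normfV !normr_nat.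
  by rewrite ler_piMl ?invr_ge0//; case: odd.
move=> x; have := @is_cvg_series_sin_coeff R x; rewrite sinE.
by rewrite sin_coeffE.
Qed.

End taylor.

(** * Bounded linear functionals vanishing on the cosines and sines of a frequency interval *)

Section bounded_functional.
Variable R : realType.

(** Replaces the passage to the limit [h -> 0] in estimates linear in [h]. *)
Lemma le_linear_eq0 (x K d : R) : 0 < d ->
  (forall h, 0 < h -> h < d -> `|x| <= K * h) -> x = 0.
Proof.
move=> d0 xK; apply/eqP; rewrite -normr_le0 leNgt; apply/negP => x0.
have K0 : 0 < `|K| + 1 by rewrite ltr_wpDl.
(* The second entry brings the bound down to [|x| / 2]; adding [1] to [|K|] keeps the denominator
   positive. *)
pose h := Num.min (d / 2) (`|x| / (2 * (`|K| + 1))).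
have h0 : 0 < h by rewrite lt_min !divr_gt0 ?mulr_gt0.
have hd : h < d by rewrite gt_min ltr_pdivrMr// ltr_pMr// ltr1n.
have := xK _ h0 hd; apply/negP; rewrite -ltNge.
apply: (@le_lt_trans _ _ ((`|K| + 1) * h)).
  by rewrite ler_pM2r// (le_trans (ler_norm _))// lerDl.
apply: (@le_lt_trans _ _ ((`|K| + 1) * (`|x| / (2 * (`|K| + 1))))).
  by rewrite ler_pM2l// ge_min lexx orbT.
have -> : (`|K| + 1) * (`|x| / (2 * (`|K| + 1))) = `|x| / 2.
  by field; rewrite gt_eqF.
by rewrite ltr_pdivrMr// ltr_pMr// ltr1n.
Qed.

Lemma continuous_norm_bounded (f : R -> R) (M : R) : continuous f ->
  exists2 A, 0 <= A & forall s : R, `|s| <= M -> `|f s| <= A.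
Proof.
move=> cf.
have /compact_bounded [A [_ fA]] : compact (f @` `[- M, M]).
  by apply: continuous_compact; [exact: continuous_subspaceT|exact: segment_compact].
exists (`|A| + 1); first by rewrite addr_ge0.
move=> s sM; apply: (fA (`|A| + 1)); first by rewrite ltr_pwDr// ler_norm.
by exists s => //=; rewrite in_itv/= -ler_norml.
Qed.

Lemma continuous_scale (F : R -> R) (k : R) : continuous F ->
  continuous (fun s : R => F (k * s)).
Proof.
move=> cF s; apply: (continuous_comp (f := fun s : R => k * s)); last exact: cF.
by apply: cvgM; [exact: cvg_cst|exact: cvg_id].
Qed.

Lemma continuous_mul (f g : R -> R) : continuous f -> continuous g ->
  continuous (fun s : R => f s * g s).
Proof. by move=> cf cg s; apply: cvgM; [exact: cf|exact: cg]. Qed.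

Lemma continuous_lin (a : R) (f g : R -> R) : continuous f -> continuous g ->
  continuous (fun s : R => a * f s + g s).
Proof.
move=> cf cg s; apply: cvgD; last exact: cg.
by apply: cvgM; [exact: cvg_cst|exact: cf].
Qed.

(** [Lam] will be the difference of the functionals of two sources: a signed functional, controlled
    by the values of [f] on [[-M, M]]. *)
Variables (Lam : (R -> R) -> R) (M C : R).
Hypothesis Lam_linear : forall (a : R) (f g : R -> R), continuous f -> continuous g ->
  Lam (fun s : R => a * f s + g s) = a * Lam f + Lam g.
Hypothesis Lam_bounded : forall (f : R -> R) (A : R), continuous f ->
  (forall s : R, `|s| <= M -> `|f s| <= A) -> `|Lam f| <= C * A.

Let eq_functional (f g : R -> R) : f =1 g -> Lam f = Lam g.
Proof. by move=> /funext ->. Qed.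

Let continuous0 : continuous (fun _ : R => 0 : R).
Proof. by move=> s; exact: cvg_cst. Qed.

Lemma functional0 : Lam (fun=> 0) = 0.
Proof.
have E : `|Lam (fun=> 0)| <= C * 0.
  by apply: Lam_bounded; [exact: continuous0|move=> s _; rewrite normr0].
by apply/eqP; rewrite -normr_le0 -[leRHS](mulr0 C).
Qed.

Lemma functionalN (f : R -> R) : continuous f ->
  Lam (fun s : R => - f s) = - Lam f.
Proof.
move=> cf; have := Lam_linear (-1) cf continuous0.
rewrite functional0 addr0 mulN1r => E; rewrite -E; apply: eq_functional => s.
by rewrite mulN1r addr0.
Qed.

(* Differentiation in the frequency [k] under [Lam], by difference quotients. *)
Lemma functional_derive (F F' : R -> R) n (k1 k2 : R) :
  continuous F -> continuous F' ->
  (forall a b : R, `|F (a + b) - F a - b * F' a| <= b ^+ 2) ->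
  (forall k : R, k1 < k < k2 -> Lam (fun s : R => s ^+ n * F (k * s)) = 0) ->
  forall k : R, k1 < k < k2 -> Lam (fun s : R => s ^+ n.+1 * F' (k * s)) = 0.
Proof.
move=> cF cF' FF' F0 k /andP[k1k kk2].
have cmon m k' G : continuous G -> continuous (fun s : R => s ^+ m * G (k' * s)).
  move=> cG; apply: continuous_mul; first exact: exprn_continuous.
  exact: continuous_scale.
(* The restriction [h < k2 - k] keeps [k + h] among the frequencies where the hypothesis applies. *)
apply: (@le_linear_eq0 _ (C * (`|M| ^+ n.+2)) (k2 - k)); first by rewrite subr_gt0.
move=> h h0 hk; set x := Lam _.
(* Up to sign, [d] is [s ^+ n] times the first-order Taylor remainder of [F] at [k * s] with
   increment [h * s]. It is of order [h ^+ 2], while [Lam] annihilates its two terms without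
   [F']. *)
pose d s := h * (s ^+ n.+1 * F' (k * s))
  + ((-1) * (s ^+ n * F ((k + h) * s)) + s ^+ n * F (k * s)).
have dE : Lam d = h * x.
  rewrite /d Lam_linear; [|exact: cmon|by apply: continuous_lin; exact: cmon].
  rewrite Lam_linear; [|exact: cmon|exact: cmon].
  rewrite !F0 ?k1k// ?mulr0 ?addr0//.
  by rewrite (lt_trans k1k) ?ltrDl//= -ltrBrDl.
have cd : continuous d.
  by apply: continuous_lin; [|apply: continuous_lin]; exact: cmon.
have : `|Lam d| <= C * (`|M| ^+ n.+2 * h ^+ 2).
  apply: Lam_bounded => // s sM.
  have -> : d s = - (s ^+ n * (F (k * s + h * s) - F (k * s) - h * s * F' (k * s))).
    by rewrite /d exprS mulrDl; ring.
  rewrite normrN normrM (le_trans (ler_wpM2l _ (FF' _ _)))//.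
  rewrite exprMn [h ^+ 2 * _]mulrC mulrA ler_wpM2r ?sqr_ge0//.
  rewrite -[s ^+ 2]real_normK ?num_real// normrX -exprD addn2 lerXn2r ?nnegrE//.
  exact: le_trans sM (ler_norm _).
rewrite dE normrM gtr0_norm// expr2 !mulrA mulrC.
by rewrite ler_pM2r.
Qed.

(** Cosine and sine go through the induction on [n] together, because differentiating one in [k]
    produces the other up to sign. *)
Lemma functional_trig0 k1 k2 :
  (forall k : R, k1 < k < k2 -> Lam (fun s : R => cos (k * s)) = 0) ->
  (forall k : R, k1 < k < k2 -> Lam (fun s : R => sin (k * s)) = 0) ->
  forall n k, k1 < k < k2 ->
    Lam (fun s : R => s ^+ n * cos (k * s)) = 0 /\ Lam (fun s : R => s ^+ n * sin (k * s)) = 0.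
Proof.
move=> c0 s0; elim=> [|n IH] k kk.
  split; [rewrite -[RHS](c0 _ kk)|rewrite -[RHS](s0 _ kk)]; apply: eq_functional => s;
    by rewrite expr0 mul1r.
have cs : continuous (@sin R) := @continuous_sin R.
have cc : continuous (@cos R) := @continuous_cos R.
have cNs : continuous (fun s : R => - sin s) by move=> s; apply: cvgN; exact: cs.
split.
  apply: functional_derive (@sin_first_order R) _ k kk => //.
  by move=> k' kk'; have [] := IH _ kk'.
have := functional_derive cc cNs (@cos_first_order R) _ kk.
move=> /(_ n (fun k' kk' => (IH k' kk').1)) E.
apply/eqP; rewrite -oppr_eq0 -functionalN; last first.
  by apply: continuous_mul; [exact: exprn_continuous|exact: continuous_scale].
by rewrite -[X in _ == X]E; apply/eqP; apply: eq_functional => s; rewrite mulrN.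
Qed.

Lemma functional_polyM (F : R -> R) : continuous F ->
  (forall n, Lam (fun s : R => s ^+ n * F s) = 0) ->
  forall p : {poly R}, Lam (fun s : R => p.[s] * F s) = 0.
Proof.
move=> cF F0 p.
have cmon n : continuous (fun s : R => s ^+ n * F s).
  by apply: continuous_mul => //; exact: exprn_continuous.
(* The induction on [p] carries a free monomial [s ^+ n], which absorbs each multiplication by
   ['X]. *)
suff /(_ 0%N) : forall n, Lam (fun s : R => s ^+ n * (p.[s] * F s)) = 0.
  move=> H; rewrite -[RHS]H; apply: eq_functional => s.
  by rewrite expr0 mul1r.
elim/poly_ind: p => [|p c IH] n.
  rewrite -[RHS]functional0; apply: eq_functional => s.
  by rewrite horner0 mul0r mulr0.
have -> : (fun s : R => s ^+ n * ((p * 'X + c%:P).[s] * F s)) =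
    fun s => c * (s ^+ n * F s) + s ^+ n.+1 * (p.[s] * F s).
  by apply/funext => s; rewrite hornerMXaddC exprS; move: (p.[s]) (F s) (s ^+ n) => a b d; ring.
rewrite Lam_linear ?F0 ?IH ?mulr0 ?addr0//.
apply: continuous_mul; first exact: exprn_continuous.
by apply: continuous_mul => //; exact: continuous_horner.
Qed.

(* Polynomial approximation of one of the two factors [F]. *)
Lemma functional_polyM_approx (F : R -> R) k : continuous F ->
  (forall X eps, 0 < eps ->
    exists p : {poly R}, forall x, `|x| <= X -> `|F x - p.[x]| <= eps) ->
  (forall x, `|F x| <= 1) ->
  (forall n, Lam (fun s : R => s ^+ n * F (k * s)) = 0) ->
  forall p : {poly R}, Lam (fun s : R => p.[s] * (F (k * s) * F (k * s))) = 0.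
Proof.
move=> cF Fapp F1 F0 p.
have cFk := continuous_scale (k := k) cF.
have cp (q : {poly R}) : continuous (fun s : R => q.[s]) by exact: continuous_horner.
have [B B0 pB] := continuous_norm_bounded M (cp p).
apply: (@le_linear_eq0 _ (C * B) 1) => // h h0 _.
have [q qh] := Fapp (`|k| * M) _ h0.
(* [Lam] vanishes on [p(s) q(k s) F(k s)], so subtracting this function replaces one factor [F] by
   [F - q], which is at most [h]. *)
have E := functional_polyM cFk F0 (- (p * (q \Po (k *: 'X)))).
have cpF : continuous (fun s : R => p.[s] * (F (k * s) * F (k * s))).
  by apply: continuous_mul => //; exact: continuous_mul.
have cqF : continuous (fun s : R => (- (p * (q \Po (k *: 'X)))).[s] * F (k * s)).
  exact: continuous_mul.
rewrite -[Lam _]mul1r -[1 * _]addr0 -[X in _ + X]E -Lam_linear//.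
rewrite -mulrA; apply: Lam_bounded; first exact: continuous_lin.
move=> s sM; rewrite mul1r hornerN hornerM horner_comp hornerZ hornerX.
rewrite [X in `|X|](_ : _ = p.[s] * (F (k * s) * (F (k * s) - q.[k * s]))).
  rewrite !normrM ler_pM ?mulr_ge0 ?pB//.
  rewrite -[leRHS]mul1r ler_pM// qh// normrM ler_wpM2l//.
by ring.
Qed.

Lemma functional_poly0 k1 k2 : k1 < k2 ->
  (forall k : R, k1 < k < k2 -> Lam (fun s : R => cos (k * s)) = 0) ->
  (forall k : R, k1 < k < k2 -> Lam (fun s : R => sin (k * s)) = 0) ->
  forall p : {poly R}, Lam (fun s : R => p.[s]) = 0.
Proof.
(* Once all derivatives in the frequency are known to vanish, the single frequency [k] suffices. *)
move=> k12 c0 s0 p; pose k := (k1 + k2) / 2.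
have kk : k1 < k < k2 by rewrite !midf_lt.
have cs : continuous (@sin R) := @continuous_sin R.
have cc : continuous (@cos R) := @continuous_cos R.
have T := functional_trig0 c0 s0.
have Ec : Lam (fun s : R => p.[s] * (cos (k * s) * cos (k * s))) = 0.
  by apply: functional_polyM_approx => // [X eps|x|n];
    [exact: cos_poly_approx|exact: cos_max|have [] := T n _ kk].
have Es : Lam (fun s : R => p.[s] * (sin (k * s) * sin (k * s))) = 0.
  by apply: functional_polyM_approx => // [X eps|x|n];
    [exact: sin_poly_approx|exact: sin_max|have [] := T n _ kk].
rewrite -[LHS](_ : 1 * Lam (fun s : R => p.[s] * (cos (k * s) * cos (k * s))) +
   Lam (fun s : R => p.[s] * (sin (k * s) * sin (k * s))) = _).
  by rewrite Ec Es mulr0 addr0.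
rewrite -Lam_linear; last 2 first.
- apply: continuous_mul; first exact: continuous_horner.
  by apply: continuous_mul; exact: continuous_scale.
- apply: continuous_mul; first exact: continuous_horner.
  by apply: continuous_mul; exact: continuous_scale.
apply: eq_functional => s.
by rewrite mul1r -mulrDr -!expr2 cos2Dsin2 mulr1.
Qed.

End bounded_functional.

(** * Moments and the support *)

(* [L] acts like integration against a positive measure whose support has the
   same closure as [E]. *)
Record positive_functional (R : realType) (E : set R) (L : (R -> R) -> R) : Prop :=
PositiveFunctional {
  pf_linear : forall (a : R) (f g : R -> R), continuous f -> continuous g ->
    L (fun s : R => a * f s + g s) = a * L f + L g ;
  pf_mono : forall f g : R -> R, continuous f -> continuous g ->
    (forall s : R, E s -> f s <= g s) -> L f <= L g ;
  pf_charge : forall s0 eps : R, E s0 -> 0 < eps -> exists2 m : R, 0 < m &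
    forall (f : R -> R) (v : R), continuous f -> 0 <= v ->
      (forall s : R, E s -> 0 <= f s) ->
      (forall s : R, `|s - s0| < eps -> v <= f s) -> m * v <= L f }.

Section positive_functional.
Variable R : realType.
Implicit Types (E : set R) (L : (R -> R) -> R).

Lemma pf_cst E L (A : R) : positive_functional E L ->
  L (fun=> A) = A * L (fun=> 1).
Proof.
move=> LE; have c (a : R) : continuous (fun _ : R => a : R).
  by move=> s; exact: cvg_cst.
have L0 : L (fun=> 0) = 0.
  suff : L (fun=> 0) = -1 * L (fun=> 0) + L (fun=> 0) by lra.
  by rewrite -(pf_linear LE _ (c 0) (c 0)) mulr0 addr0.
rewrite -[RHS]addr0 -[X in _ + X]L0.
by rewrite -(pf_linear LE _ (c 1) (c 0)) mulr1 addr0.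
Qed.

(** By monotonicity the total mass [L 1] is a bound for the norm; this makes a difference of two
    such functionals an instance of [Lam]. *)
Lemma pf_bounded E L (M : R) (f : R -> R) (A : R) : positive_functional E L ->
  (forall s : R, E s -> `|s| <= M) -> continuous f ->
  (forall s : R, `|s| <= M -> `|f s| <= A) -> `|L f| <= A * L (fun=> 1).
Proof.
move=> LE EM cf fA; have c (a : R) : continuous (fun _ : R => a : R).
  by move=> s; exact: cvg_cst.
rewrite ler_norml -mulNr -!(pf_cst _ LE); apply/andP; split; apply: (pf_mono LE) => //.
  by move=> s /EM /fA; rewrite ler_norml => /andP[].
by move=> s /EM /fA; rewrite ler_norml => /andP[].
Qed.

(** Otherwise [m <= C * (p / q) ^+ n] for all [n], and the right-hand side tends to [0]. *)
Lemma geometric_domination (p q m C : R) : 0 <= p -> p < q -> 0 < m ->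
  (forall n, m * q ^+ n <= C * p ^+ n) -> False.
Proof.
move=> p0 pq m0 H; have q0 : 0 < q := le_lt_trans p0 pq.
have r1 : `|p / q| < 1.
  by rewrite ger0_norm ?divr_ge0 ?(ltW q0)// ltr_pdivrMr// mul1r.
have h : C * (p / q) ^+ n @[n --> \oo] --> C * 0.
  by apply: cvgM; [exact: cvg_cst|exact: cvg_expr].
have : m <= C * 0.
  apply: (ler_cvg_to (cvg_cst m) h); near=> n.
  by rewrite expr_div_n mulrA ler_pdivlMr ?exprn_gt0// H.
by rewrite mulr0 leNgt m0.
Unshelve. all: by end_near. Qed.

(* The moments of an affine function [l] grow like the powers of its maximum
   over the support. *)
Lemma pf_affine_le E E' L L' (a b p : R) :
  positive_functional E L -> positive_functional E' L' ->
  (forall q : {poly R}, L (fun s : R => q.[s]) = L' (fun s : R => q.[s])) ->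
  `|a| <= 1 -> 0 <= p ->
  (forall s : R, E s -> 0 <= a * s + b <= p) ->
  (forall s : R, E' s -> 0 <= a * s + b) ->
  forall s : R, E' s -> a * s + b <= p.
Proof.
move=> LE LE' LL' a1 p0 El E'l s1 E's1; rewrite leNgt; apply/negP => ps1.
(* Half the excess at [s1]: since [|a| <= 1], the affine function is still at least [p + e] within
   distance [e] of [s1]. Hence the [n]-th moment under [L'] is at least [m * (p + e) ^+ n], with [m]
   independent of [n], while under [L] it is at most [p ^+ n] times the total mass. *)
pose e := (a * s1 + b - p) / 2.
have e0 : 0 < e by rewrite divr_gt0// subr_gt0.
have [m m0 mP] := pf_charge LE' E's1 e0.
apply: (@geometric_domination p (p + e) m (L (fun=> 1))) => //.
  by rewrite ltrDl.
move=> n; pose q := (a *: 'X + b%:P) ^+ n : {poly R}.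
have qE (s : R) : q.[s] = (a * s + b) ^+ n by rewrite /q !hornerE.
have cq : continuous (fun s : R => q.[s]) by exact: continuous_horner.
have pe0 : 0 <= p + e by rewrite addr_ge0// ltW.
apply: (@le_trans _ _ (L' (fun s : R => q.[s]))).
  apply: mP => //; first by rewrite exprn_ge0.
    by move=> s Es; rewrite qE exprn_ge0// E'l.
  move=> s se; rewrite qE; suff : p + e <= a * s + b.
    by move=> h; rewrite lerXn2r// nnegrE// (le_trans pe0).
  have : `|a * (s - s1)| <= e.
    by rewrite normrM (le_trans _ (ltW se))// ler_piMl.
  rewrite ler_norml => /andP[+ _]; rewrite /e mulrBr; lra.
rewrite -LL' mulrC -(pf_cst _ LE).
apply: (pf_mono LE) => // [|s Es]; first by move=> ?; exact: cvg_cst.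
by have /andP[h1 h2] := El _ Es; rewrite qE lerXn2r// nnegrE.
Qed.

(** The difference [L - L'] vanishes on all polynomials by [functional_poly0]. Then [pf_affine_le]
    is applied to [s + M] for upper bounds and to [M - s] for lower bounds; the shift by [M] makes
    both nonnegative on the two sets. *)
Lemma pf_bounds_transfer E E' L L' (M k1 k2 : R) :
  positive_functional E L -> positive_functional E' L' ->
  E !=set0 ->
  (forall s : R, E s -> `|s| <= M) -> (forall s : R, E' s -> `|s| <= M) ->
  k1 < k2 ->
  (forall k : R, k1 < k < k2 ->
     L (fun s : R => cos (k * s)) = L' (fun s : R => cos (k * s)) /\
     L (fun s : R => sin (k * s)) = L' (fun s : R => sin (k * s))) ->
  ubound E `<=` ubound E' /\ lbound E `<=` lbound E'.
Proof.
move=> LE LE' [s0 Es0] EM E'M k12 H.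
have Hlin (a : R) (f g : R -> R) : continuous f -> continuous g ->
    L (fun s : R => a * f s + g s) - L' (fun s : R => a * f s + g s) =
    a * (L f - L' f) + (L g - L' g).
  by move=> cf cg; rewrite (pf_linear LE)// (pf_linear LE')//; ring.
have Hbd (f : R -> R) (A : R) : continuous f ->
    (forall s : R, `|s| <= M -> `|f s| <= A) ->
    `|L f - L' f| <= (L (fun=> 1) + L' (fun=> 1)) * A.
  move=> cf fA; rewrite (le_trans (ler_normB _ _))// mulrC mulrDr.
  by apply: lerD; [exact: pf_bounded LE EM cf fA|exact: pf_bounded LE' E'M cf fA].
have LL' (q : {poly R}) : L (fun s : R => q.[s]) = L' (fun s : R => q.[s]).
  apply/eqP; rewrite -subr_eq0; apply/eqP.
  apply: (functional_poly0 (Lam := fun f => L f - L' f) Hlin Hbd k12) => k kk.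
    by have [-> _] := H k kk; rewrite subrr.
  by have [_ ->] := H k kk; rewrite subrr.
have M0 : 0 <= M by rewrite (le_trans _ (EM _ Es0)).
split=> u uE s1 E's1.
- have Eu : - M <= u.
    by apply: le_trans (uE _ Es0); have := EM _ Es0; rewrite ler_norml => /andP[].
  rewrite -(lerD2r M) -[s1]mul1r.
  apply: (pf_affine_le LE LE' LL') => //.
  + by rewrite normr1.
  + by rewrite -lerBlDr sub0r.
  + move=> s Es; rewrite mul1r lerD2r uE// andbT -lerBlDr sub0r.
    by have := EM _ Es; rewrite ler_norml => /andP[].
  + move=> s Es; rewrite mul1r -lerBlDr sub0r.
    by have := E'M _ Es; rewrite ler_norml => /andP[].
- have Eu : u <= M.
    by apply: le_trans (uE _ Es0) _; have := EM _ Es0; rewrite ler_norml => /andP[].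
  rewrite -lerN2 -(lerD2r M) -[- s1]mulN1r.
  apply: (pf_affine_le LE LE' LL') => //.
  + by rewrite normrN1.
  + by rewrite addrC subr_ge0.
  + move=> s Es; rewrite mulN1r lerD2r lerN2 uE// andbT addrC subr_ge0.
    by have := EM _ Es; rewrite ler_norml => /andP[].
  + move=> s Es; rewrite mulN1r addrC subr_ge0.
    by have := E'M _ Es; rewrite ler_norml => /andP[].
Qed.

End positive_functional.

(** * The functional defined by a source *)

Section ae_integral.
Context d (T : measurableType d) (R : realType) (mu : {measure set T -> \bar R}).
Variable D : set T.
Hypotheses (mD : measurable D) (muD : (mu D < +oo)%E).
Implicit Types f g : T -> R.

Lemma ae_bounded_integrable g (A : R) : measurable_fun D g ->
  {ae mu, forall x, D x -> `|g x| <= A} -> mu.-integrable D (EFin \o g).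
Proof.
move=> mg gA; apply/integrableP; split; first exact/measurable_EFinP.
apply: le_lt_trans.
  (* The absolute value guarantees a nonnegative bound: [A] may be negative when [D] is
     negligible. *)
  apply: (integral_le_bound (`|A|)%:E) => //; first exact/measurable_EFinP.
  by apply: filterS gA => x /[apply] gA; rewrite lee_fin (le_trans gA)// ler_norm.
by rewrite lte_mul_pinfty.
Qed.

Lemma ae_le_Rintegral f g :
  mu.-integrable D (EFin \o f) -> mu.-integrable D (EFin \o g) ->
  {ae mu, forall x, D x -> f x <= g x} ->
  \int[mu]_(x in D) f x <= \int[mu]_(x in D) g x.
Proof.
move=> intf intg fg; rewrite -subr_ge0 -RintegralB//.
have mB : measurable_fun D (fun x => g x - f x).
  by apply: measurable_funB; apply/measurable_EFinP;
    [exact: measurable_int intg|exact: measurable_int intf].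
(* The difference [g - f] is nonnegative only almost everywhere; its absolute value has the same
   integral and is nonnegative everywhere. *)
rewrite (_ : \int[mu]_(x in D) _ = \int[mu]_(x in D) `|g x - f x|).
  by apply: Rintegral_ge0.
congr fine; apply: ae_eq_integral => //.
- exact/measurable_EFinP.
- by apply/measurable_EFinP; exact: measurableT_comp.
- by apply: filterS fg => x /[apply] h; rewrite ger0_norm// subr_ge0.
Qed.

Lemma ae_le_normr_Rintegral g (A : R) : measurable_fun D g ->
  {ae mu, forall x, D x -> `|g x| <= A} ->
  `|\int[mu]_(x in D) g x| <= A * fine (mu D).
Proof.
move=> mg gA; have ig := ae_bounded_integrable mg gA.
rewrite -Rintegral_cst// (le_trans (le_normr_Rintegral mD ig))//.
apply: ae_le_Rintegral => //; first exact: (integrable_abse ig).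
apply: (@ae_bounded_integrable _ `|A|); first exact: measurable_cst.
exact: aeW.
Qed.

(** A Markov-type inequality, used once in space and once in time to bound the charge near a point
    from below. *)
Lemma Rintegral_ge_indic (U : set T) g (a : R) : measurable U -> U `<=` D ->
  mu.-integrable D (EFin \o g) ->
  {ae mu, forall x, D x -> a * \1_U x <= g x} ->
  a * fine (mu U) <= \int[mu]_(x in D) g x.
Proof.
move=> mU UD ig ag.
have iU : mu.-integrable D (EFin \o \1_U).
  apply: (@ae_bounded_integrable _ 1); first exact: measurable_indic.
  by apply: aeW => x _; rewrite indicE ger0_norm ?ler0n// lern1 leq_b1.
have -> : mu U = (\int[mu]_(x in D) (\1_U x)%:E)%E.
  by rewrite integral_indic// setIidl.
rewrite -(RintegralZl _ mD iU); apply: ae_le_Rintegral => //.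
rewrite (_ : EFin \o _ = (fun x => a%:E * (EFin \o \1_U) x)%E).
  exact: integrableZl.
by apply/funext => x; rewrite /= EFinM.
Qed.

End ae_integral.

(** * Integration of functions of the retarded time [t - h y] against the source *)

Section retarded_functional.
Context d (T : measurableType d) (R : realType) (mu : {measure set T -> \bar R}).
Variables (D : set T) (h : T -> R) (B : R) (S : T -> R -> R) (tmin tmax : R).
Hypotheses (mD : measurable D) (muD : (mu D < +oo)%E).
Hypotheses (mh : measurable_fun D h) (hB : forall y, D y -> `|h y| <= B).
(** Every value taken by [h] on [D] lies in the support of the image measure. For [h := dot xh] and
    [D] open this is the positivity of the measure of nonempty open sets. *)
Hypothesis muU : forall z, D z -> forall e : R, 0 < e ->
  (0 < mu (D `&` [set y | (`|h y - h z| < e)%R]))%E.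
Hypothesis tminmax : tmin < tmax.
Hypothesis mS : forall t, tmin <= t <= tmax ->
  measurable_fun D (fun y => S y t) /\
  exists M : R, {ae mu, forall y, D y -> `|S y t| <= M}.
Hypothesis cS : forall t0, tmin <= t0 <= tmax -> forall eps : R, 0 < eps ->
  exists2 delta : R, 0 < delta &
    forall t, tmin <= t <= tmax -> `|t - t0| < delta ->
      {ae mu, forall y, D y -> `|S y t - S y t0| <= eps}.
Hypothesis S_gt0 : exists2 c0 : R, 0 < c0 &
  forall t, tmin <= t <= tmax -> {ae mu, forall y, D y -> c0 <= S y t}.

(** With [h := dot xh] and [f] a cosine or sine of frequency [k], this is the inner integral of the
    far field. *)
Definition retarded (f : R -> R) (t : R) : R :=
  \int[mu]_(y in D) (f (t - h y) * S y t).

Definition retarded_total (f : R -> R) : R :=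
  \int[@lebesgue_measure R]_(t in `[tmin, tmax]) retarded f t.

Let mfh (f : R -> R) t : continuous f -> measurable_fun D (fun y => f (t - h y)).
Proof.
move=> cf; apply: (measurableT_comp (continuous_measurable_fun cf)).
by apply: measurable_funB => //; exact: measurable_cst.
Qed.

Let le_th t y : D y -> `|t - h y| <= `|t| + B.
Proof. by move=> Dy; rewrite (le_trans (ler_normB _ _))// lerD2l hB. Qed.

Lemma retarded_integrable (f : R -> R) t : continuous f -> tmin <= t <= tmax ->
  mu.-integrable D (EFin \o (fun y => f (t - h y) * S y t)).
Proof.
move=> cf tI; have [mSt [M SM]] := mS tI.
have [A A0 fA] := continuous_norm_bounded (`|t| + B) cf.
apply: (ae_bounded_integrable mD muD (A := A * M)).
  by apply: measurable_funM => //; exact: mfh.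
by apply: filterS SM => y SMy Dy; rewrite normrM ler_pM ?SMy// fA// le_th.
Qed.

Lemma retarded_linear (a : R) (f g : R -> R) t : continuous f -> continuous g ->
  tmin <= t <= tmax ->
  retarded (fun s : R => a * f s + g s) t = a * retarded f t + retarded g t.
Proof.
move=> cf cg tI; have If := retarded_integrable cf tI.
have Ig := retarded_integrable cg tI.
rewrite /retarded -RintegralZl// -RintegralD//.
  by apply: eq_Rintegral => y _; rewrite mulrDl mulrA.
rewrite (_ : EFin \o _ = (fun x => a%:E * (f (t - h x) * S x t)%:E)%E).
  exact: integrableZl.
by apply/funext => x; rewrite /= EFinM.
Qed.

Lemma retarded_le (f g : R -> R) t : continuous f -> continuous g ->
  tmin <= t <= tmax ->
  (forall y, D y -> f (t - h y) <= g (t - h y)) -> retarded f t <= retarded g t.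
Proof.
move=> cf cg tI fg; have [c0 c00 /(_ _ tI) Sc] := S_gt0.
apply: ae_le_Rintegral => //; try exact: retarded_integrable.
apply: filterS Sc => y /[swap] Dy /(_ Dy) Sc.
by rewrite ler_wpM2r ?fg// (le_trans (ltW c00)).
Qed.

(** Uniform continuity near a segment: compactness in its near-covering form reduces it to joint
    continuity of [f (s + e) - f s] at each [(s, 0)]. *)
Lemma uniform_shift (f : R -> R) (M eps : R) : continuous f -> 0 < eps ->
  \forall e \near (0 : R), forall s : R, `|s| <= M -> `|f (s + e) - f s| <= eps.
Proof.
move=> cf eps0.
have /compact_near_coveringP nc := @segment_compact R (- M) M.
have H := nc R (nbhs (0 : R)) (fun e s => `|f (s + e) - f s| <= eps) (nbhs_filter _).
apply: filterS (H _) => [e He s sM|s _].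
  by apply: He; rewrite /= in_itv/= -ler_norml.
have cfs : (f (z.1 + z.2) - f z.1) @[z --> (s, 0 : R)] --> f (s + 0) - f s.
  apply: cvgB; last first.
    by apply: (continuous_comp (f := fst)); [exact: cvg_fst|exact: cf].
  apply: (continuous_comp (f := fun z : R * R => z.1 + z.2)); last exact: cf.
  by apply: cvgD; [exact: cvg_fst|exact: cvg_snd].
rewrite addr0 subrr in cfs.
have /cvgr0Pnorm_le := cfs.
by move=> /(_ _ eps0).
Qed.

(** This continuity in [t] is what makes [retarded f] integrable over the time interval. *)
Lemma retarded_continuous (f : R -> R) : continuous f ->
  {within `[tmin, tmax], continuous (retarded f)}.
Proof.
move=> cf; apply/subspace_continuousP => t0; rewrite /= in_itv/= => t0I.
have [mSt0 [M SM]] := mS t0I.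
have [A A0 fA] := continuous_norm_bounded (`|t0| + B) cf.
apply/cvgrPdist_le => eps eps0.
(* [|M| + 1] will bound [S y t] for [t] near [t0], because [eta <= 1], and [A] bounds [f]; the last
   [+ 1] keeps [K] positive even when [D] has measure zero. *)
pose K := (`|M| + 1 + A) * fine (mu D) + 1.
have K0 : 0 < K.
  by rewrite ltr_wpDl// mulr_ge0// ?fine_ge0// addr_ge0// addr_ge0.
pose eta := Num.min 1 (eps / K).
have eta0 : 0 < eta by rewrite lt_min ltr01 divr_gt0.
have [delta delta0 Sdelta] := cS t0I eta0.
have near1 : \forall t \near t0, `|t - t0| < delta.
  by apply/nbhs_ballP; exists delta => // t; rewrite /ball/= distrC.
have near2 : \forall t \near t0,
    forall s : R, `|s| <= `|t0| + B -> `|f (s + (t - t0)) - f s| <= eta.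
  have : (t - t0) @[t --> t0] --> (0 : R).
    by rewrite -(subrr t0); apply: cvgB; [exact: cvg_id|exact: cvg_cst].
  by move=> /(_ _ (uniform_shift (`|t0| + B) cf eta0)).
rewrite near_withinE; near=> t => /=; rewrite in_itv/= => tI.
have td : `|t - t0| < delta by near: t; exact: near1.
have tf : forall s : R, `|s| <= `|t0| + B -> `|f (s + (t - t0)) - f s| <= eta.
  by near: t; exact: near2.
have [mSt _] := mS tI.
rewrite /retarded -RintegralB//; try exact: retarded_integrable.
have : (eta * (`|M| + 1 + A)) * fine (mu D) <= eps.
  rewrite -mulrA (@le_trans _ _ (eta * K))//.
    by rewrite ler_wpM2l ?(ltW eta0)// lerDl.
  by rewrite -ler_pdivlMr// ge_min lexx orbT.
apply: le_trans; apply: ae_le_normr_Rintegral => //.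
  by apply: measurable_funB; apply: measurable_funM => //; exact: mfh.
apply: filterS2 SM (Sdelta t tI td) => y SMy Sty Dy.
have {}SMy := SMy Dy; have {}Sty := Sty Dy.
(* The first product is small by the uniform shift of [f], the second by the continuity of [S] in
   time. *)
have -> : f (t0 - h y) * S y t0 - f (t - h y) * S y t =
  (f (t0 - h y) - f (t - h y)) * S y t - f (t0 - h y) * (S y t - S y t0) by ring.
rewrite (le_trans (ler_normB _ _))// [leRHS]mulrDr lerD//.
  rewrite normrM ler_pM//.
    have := tf (t0 - h y) (le_th _ Dy); rewrite distrC.
    by have -> : t0 - h y + (t - t0) = t - h y by ring.
  rewrite -[S y t](subrK (S y t0)) addrC (le_trans (ler_normD _ _))// lerD//.
    by rewrite (le_trans SMy)// ler_norm.
  by rewrite (le_trans Sty)// ge_min lexx.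
by rewrite normrM mulrC ler_pM// fA// le_th.
Unshelve. all: by end_near. Qed.

Let retarded_integrable_time (f : R -> R) : continuous f ->
  (@lebesgue_measure R).-integrable `[tmin, tmax] (EFin \o retarded f).
Proof.
move=> cf; apply: continuous_compact_integrable; first exact: segment_compact.
exact: retarded_continuous.
Qed.

(** Linearity and monotonicity come from the integrals and the positivity of [S]. The charge near
    [t0 - h z] is bounded below by restricting to [y] in [U] and [t] in [V], where [t - h y] stays
    within [eps / 2 + eps / 2] of it and [S] is at least [c0]. *)
Lemma retarded_total_pf :
  positive_functional
    [set s | exists t y, [/\ tmin <= t <= tmax, D y & s = t - h y]] retarded_total.
Proof.
have mI : measurable (`[tmin, tmax]%classic : set R) by exact: measurable_itv.
have II := retarded_integrable_time.
split.
- move=> a f g cf cg; rewrite /retarded_total -RintegralZl ?II//.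
  rewrite -RintegralD ?II//; last first.
    rewrite (_ : EFin \o _ = (fun x => a%:E * (retarded f x)%:E)%E).
      by apply: integrableZl => //; exact: II.
    by apply/funext => x; rewrite /= EFinM.
  apply: eq_Rintegral => t; rewrite inE/= in_itv/= => tI.
  exact: retarded_linear.
- move=> f g cf cg fg; apply: le_Rintegral; rewrite ?II// => t.
  rewrite /= in_itv/= => tI; apply: retarded_le => // y Dy.
  by apply: fg; exists t, y.
- move=> s0 eps [t0 [z [t0I Dz ->]]] eps0.
  have [c0 c00 Sc] := S_gt0.
  have e20 : 0 < eps / 2 by rewrite divr_gt0.
  pose U := D `&` [set y | `|h y - h z| < eps / 2].
  have mU : measurable U.
    have -> : U = D `&` h @^-1` (ball (h z) (eps / 2)).
      by apply/seteqP; split=> y [Dy]; rewrite /ball/= distrC => yz; split.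
    by apply: mh => //; exact: measurable_ball.
  have UD : U `<=` D by move=> y [].
  have muUoo : (mu U < +oo)%E by apply: le_lt_trans muD; apply: le_measure; rewrite ?inE.
  have U0 : 0 < fine (mu U) by rewrite fine_gt0// muUoo muU.
  pose V : set R := `[tmin, tmax] `&` ball t0 (eps / 2).
  have mV : measurable V by apply: measurableI => //; exact: measurable_ball.
  have VI : V `<=` `[tmin, tmax] by move=> y [].
  have Ioo : (lebesgue_measure (`[tmin, tmax]%classic : set R) < +oo)%E.
    by rewrite lebesgue_measure_itv/= lte_fin tminmax ltry.
  have muVoo : (lebesgue_measure V < +oo)%E.
    by apply: le_lt_trans Ioo; apply: le_measure; rewrite ?inE.
  have V0 : 0 < fine (lebesgue_measure V).
    rewrite fine_gt0// muVoo andbT.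
    (* Since [t0] may be an end point of the time interval, [V] is bounded below by the open
       interval from [a] to [b] rather than by a full ball. *)
    pose a := Num.max tmin (t0 - eps / 2); pose b := Num.min tmax (t0 + eps / 2).
    have ab : a < b.
      have /andP[t0a t0b] := t0I; have tt := tminmax.
      by rewrite gt_max !lt_min; apply/andP; split; apply/andP; split; lra.
    apply: (@lt_le_trans _ _ (lebesgue_measure (`]a, b[%classic : set R))).
      by rewrite lebesgue_measure_itv/= lte_fin ab -EFinB lte_fin subr_gt0.
    apply: le_measure; rewrite ?inE//.
    move=> t /=; rewrite in_itv/= gt_max lt_min => /andP[/andP[ta1 ta2] /andP[tb1 tb2]].
    split; first by rewrite /= in_itv/= !ltW.
    by rewrite /ball/= ltr_distl; apply/andP; split; lra.
  exists (c0 * fine (mu U) * fine (lebesgue_measure V)); first by rewrite !mulr_gt0.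
  move=> f v cf v0 f0 fv; rewrite mulrAC.
  apply: Rintegral_ge_indic => //; first exact: II.
  apply: aeW => t; rewrite /= in_itv/= => tI.
  rewrite indicE; have [tV|_] := boolP (t \in V); last first.
    (* Outside [V] the required bound is [0], obtained by comparing [f] with the zero function. *)
    rewrite mulr0; have -> : 0 = retarded (fun=> 0) t.
      rewrite /retarded (_ : (fun y => 0 * S y t) = fun=> 0).
        by rewrite Rintegral_cst// mul0r.
      by apply/funext => y; rewrite mul0r.
    apply: retarded_le => //; first by move=> ?; exact: cvg_cst.
    by move=> y Dy; apply: f0; exists t, y.
  rewrite mulr1 mulrAC; apply: Rintegral_ge_indic => //.
    exact: retarded_integrable.
  apply: filterS (Sc t tI) => y /[swap] Dy /(_ Dy) Scy.
  rewrite indicE; have [yU|_] := boolP (y \in U); last first.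
    rewrite mulr0 mulr_ge0//; first by apply: f0; exists t, y.
    exact: le_trans (ltW c00) Scy.
  rewrite mulr1 mulrC ler_pM ?(ltW c00)// fv//.
  move: yU tV; rewrite !inE => -[_ /= yz] [_]; rewrite /ball/= distrC => tt.
  have -> : t - h y - (t0 - h z) = (t - t0) - (h y - h z) by ring.
  by rewrite (le_lt_trans (ler_normB _ _))// [ltRHS]splitr ltrD.
Qed.

End retarded_functional.

(** * Far fields *)

Section leb3.
Variable R : realType.
Local Notation mR := (measurableTypeR R).
Local Notation mu := ((@lebesgue_measure R \x @lebesgue_measure R) \x
  @lebesgue_measure R)%E.
Implicit Types (A D : set (pt R)) (x y z : pt R).

(** Balls of the product topology are cubes, hence boxes for the product sigma-algebra. *)
Lemma ball3E x (e : R) :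
  ball x e = (ball x.1.1 e `*` ball x.1.2 e) `*` ball x.2 e.
Proof. by []. Qed.

Lemma measurable_ball3 x (e : R) : measurable (ball x e : set (mR * mR * mR)).
Proof.
rewrite ball3E; apply: measurableX; last exact: measurable_ball.
by apply: measurableX; exact: measurable_ball.
Qed.

Lemma leb3_ball x (e : R) : 0 <= e ->
  mu (ball x e : set (mR * mR * mR)) = ((e *+ 2) ^+ 3)%:E.
Proof.
move=> e0; rewrite ball3E product_measure1E; last 2 first.
- by apply: measurableX; exact: measurable_ball.
- exact: measurable_ball.
rewrite [X in (X * _)%E]product_measure1E; [|exact: measurable_ball..].
have b (a : R) := lebesgue_measure_ball a e0.
rewrite !exprS expr0 mulr1 mulrA !EFinM.
by congr (_ * _ * _)%E; exact: b.
Qed.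

Lemma ball_ratr (a e : R) : 0 < e -> exists q : rat, ball (ratr q : R) e a.
Proof.
move=> e0; have [q] : exists q : rat, ratr q \in `]a, (a + e)[.
  by apply: rat_in_itvoo; rewrite ltrDl.
rewrite in_itv/= => /andP[aq qe]; exists q.
by rewrite /ball/= gtr0_norm ?subr_gt0// ltrBlDl.
Qed.

(** An open set is a countable union of cubes with rational centres and radii [1 / (n + 1)], which
    links the topology to the product sigma-algebra. *)
Lemma open_measurable3 A : open A -> measurable (A : set (mR * mR * mR)).
Proof.
move=> oA.
pose c (i : rat * rat * rat * nat) : pt R :=
  (ratr i.1.1.1, ratr i.1.1.2, ratr i.1.2).
pose r (i : rat * rat * rat * nat) : R := i.2.+1%:R^-1.
(* [F i] is the whole cube when it fits inside [A] and empty otherwise, so the union may run over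
   all indices. *)
pose F i := [set y | ball (c i) (r i) y /\ ball (c i) (r i) `<=` A].
have -> : A = \bigcup_i F i.
  apply/seteqP; split=> [x Ax|x [i _ [xi]]]; last exact.
  have /nbhs_ballP[e /= e0 xeA] : nbhs x A by apply: open_nbhs_nbhs; split.
  have e20 : 0 < e / 2 by rewrite divr_gt0.
  have [n _ /(_ n (leqnn n)) /= ne] := near_infty_natSinv_lt (PosNum e20).
  have n0 : 0 < (n.+1%:R^-1 : R) by rewrite invr_gt0.
  have [q1 xq1] := ball_ratr x.1.1 n0.
  have [q2 xq2] := ball_ratr x.1.2 n0.
  have [q3 xq3] := ball_ratr x.2 n0.
  have xq : ball (c (q1, q2, q3, n)) (r (q1, q2, q3, n)) x by split.
  exists (q1, q2, q3, n) => //; split=> // y yq; apply: xeA.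
  rewrite [e]splitr; apply: (ball_triangle (y := c (q1, q2, q3, n))).
    by apply/ball_sym; apply: le_ball xq; exact: ltW.
  by apply: le_ball yq; exact: ltW.
apply: countable_bigcupT_measurable; first exact: countableP.
move=> i; have [h|h] := pselect (ball (c i) (r i) `<=` A).
  rewrite (_ : F i = ball (c i) (r i)); first exact: measurable_ball3.
  by apply/seteqP; split=> y; [case|].
rewrite (_ : F i = set0); first exact: measurable0.
by apply/seteqP; split=> y // [].
Qed.

Lemma open_leb3_gt0 A x : open A -> A x -> (0 < mu A)%E.
Proof.
move=> oA Ax.
have /nbhs_ballP[e /= e0 xeA] : nbhs x A by apply: open_nbhs_nbhs; split.
apply: (@lt_le_trans _ _ (mu (ball x e))).
  by rewrite leb3_ball ?ltW// lte_fin exprn_gt0// mulrn_wgt0.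
by apply: le_measure => //; rewrite inE;
  [exact: measurable_ball3|exact: open_measurable3].
Qed.

Lemma bounded3_leb3 D : open D -> bounded3 D -> (mu D < +oo)%E.
Proof.
move=> oD [M DM].
apply: (@le_lt_trans _ _ (mu (ball (0 : pt R) (`|M| + 1)))).
  apply: le_measure => //; rewrite ?inE.
  - exact: open_measurable3.
  - exact: measurable_ball3.
  - move=> y /DM [y1 [y2 y3]]; have MM : M < `|M| + 1 by rewrite ltr_pwDr// ler_norm.
    by split; [split|]; rewrite /ball/= sub0r normrN; apply: le_lt_trans MM.
by rewrite leb3_ball ?addr_ge0// ltry.
Qed.

Lemma continuous_dot x : continuous (dot x).
Proof.
move=> y.
have c1 : z.1.1 @[z --> y] --> y.1.1.
  by apply: (continuous_comp (f := fst) (g := fst)); exact: cvg_fst.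
have c2 : z.1.2 @[z --> y] --> y.1.2.
  by apply: (continuous_comp (f := fst) (g := snd)); [exact: cvg_fst|exact: cvg_snd].
have c3 : z.2 @[z --> y] --> y.2 by exact: cvg_snd.
by apply: cvgD; [apply: cvgD|]; apply: cvgM => //; exact: cvg_cst.
Qed.

Lemma measurable_dot x : measurable_fun [set: mR * mR * mR] (dot x).
Proof.
apply: measurable_funD; [apply: measurable_funD|];
  (apply: measurable_funM; first exact: measurable_cst).
- exact: (measurableT_comp measurable_fst measurable_fst).
- exact: (measurableT_comp measurable_snd measurable_fst).
- exact: measurable_snd.
Qed.

Lemma bounded3_dot D x : bounded3 D ->
  exists2 B : R, 0 <= B & forall y, D y -> `|dot x y| <= B.
Proof.
move=> [M DM]; exists ((`|x.1.1| + `|x.1.2| + `|x.2|) * `|M|).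
  by rewrite mulr_ge0// !addr_ge0.
have MM : M <= `|M| by rewrite ler_norm.
move=> y /DM [y1 [y2 y3]]; rewrite /dot !mulrDl.
rewrite (le_trans (ler_normD _ _))// lerD//.
  rewrite (le_trans (ler_normD _ _))// lerD// normrM ler_wpM2l//.
    exact: le_trans MM.
  exact: le_trans MM.
by rewrite normrM ler_wpM2l// (le_trans _ MM).
Qed.

Lemma dot_vopp x y : dot (vopp x) y = - dot x y.
Proof. by rewrite /dot /vopp/=; ring. Qed.

End leb3.

(** * From far fields to bounds on the arrival times *)

Section farfield.
Variable R : realType.
Implicit Types (D : set (pt R)) (S : pt R -> R -> R) (xh : pt R).
Local Notation mu := ((@lebesgue_measure R \x @lebesgue_measure R) \x
  @lebesgue_measure R)%E.

(** The values of the phase [t - xh.y]: up to closure, the support of the measure whose Fourier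
    transform is the far field. *)
Definition arrival D xh (tmin tmax : R) : set R :=
  [set s | exists t y, [/\ tmin <= t <= tmax, D y & s = t - dot xh y]].

Lemma standing_pf D S (tmin tmax : R) xh : standing D S tmin tmax ->
  positive_functional (arrival D xh tmin tmax)
    (retarded_total mu D (dot xh) S tmin tmax).
Proof.
move=> [_ [oD [_ [bD [_ [_ [[_ tt] [mS [cS S0]]]]]]]]].
have [B _ hB] := bounded3_dot xh bD.
apply: (@retarded_total_pf _ _ R mu D (dot xh) B S tmin tmax).
- exact: open_measurable3.
- exact: bounded3_leb3.
- by apply: measurable_funTS; exact: measurable_dot.
- exact: hB.
- move=> z Dz e e0; apply: (@open_leb3_gt0 _ _ z).
    apply: openI => //.
    rewrite (_ : [set y | _] = dot xh @^-1` (ball (dot xh z) e)).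
      apply: open_comp; last exact: ball_open.
      by move=> y _; exact: continuous_dot.
    by apply/seteqP; split=> y /=; rewrite /ball/= distrC.
  by split=> //=; rewrite subrr normr0.
- exact: tt.
- by move=> t /mS [mSt]; split=> //; exact: mSt.
- exact: cS.
- exact: S0.
Qed.

Lemma arrival_bounded D S (tmin tmax : R) xh : standing D S tmin tmax ->
  exists2 M : R, 0 <= M & forall s, arrival D xh tmin tmax s -> `|s| <= M.
Proof.
move=> [_ [_ [_ [bD [_ [_ [[t0 tt] _]]]]]]].
have [B B0 hB] := bounded3_dot xh bD.
exists (tmax + B); first by rewrite addr_ge0// (le_trans t0)// ltW.
move=> _ [t [y [/andP[t1 t2] Dy ->]]].
by rewrite (le_trans (ler_normB _ _))// lerD ?hB// ger0_norm// (le_trans t0).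
Qed.

Lemma arrival_neq0 D S (tmin tmax : R) xh : standing D S tmin tmax ->
  arrival D xh tmin tmax !=set0.
Proof.
move=> [[y Dy] [_ [_ [_ [_ [_ [[_ tt] _]]]]]]].
by exists (tmin - dot xh y), tmin, y; rewrite lexx ltW.
Qed.

Lemma farfieldE D S (tmin tmax : R) xh (k : R) :
  farfield D S tmin tmax xh k = Complex
    (retarded_total mu D (dot xh) S tmin tmax (fun s : R => cos (k * s)) / Num.sqrt (2 * pi))
    (retarded_total mu D (dot xh) S tmin tmax (fun s : R => sin (k * s)) / Num.sqrt (2 * pi)).
Proof. by []. Qed.

(** The nonzero normalising factor cancels in the real and imaginary parts. *)
Lemma farfield_inj D D' S S' (tmin tmax tmax' : R) xh (k : R) :
  farfield D S tmin tmax xh k = farfield D' S' tmin tmax' xh k ->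
  retarded_total mu D (dot xh) S tmin tmax (fun s : R => cos (k * s)) =
  retarded_total mu D' (dot xh) S' tmin tmax' (fun s : R => cos (k * s)) /\
  retarded_total mu D (dot xh) S tmin tmax (fun s : R => sin (k * s)) =
  retarded_total mu D' (dot xh) S' tmin tmax' (fun s : R => sin (k * s)).
Proof.
have s0 : (Num.sqrt (2 * pi))^-1 != 0 :> R.
  by rewrite invr_neq0// gt_eqF// sqrtr_gt0 mulr_gt0// pi_gt0.
rewrite !farfieldE.
move: (retarded_total _ _ _ _ _ _ _) (retarded_total _ _ _ _ _ _ _).
move: (retarded_total _ _ _ _ _ _ _) (retarded_total _ _ _ _ _ _ _).
move=> a b c d [re im].
by split; apply: (mulIf s0).
Qed.

Lemma arrival_bounds D D' S S' (tmin tmax tmax' : R) xh (kmin kmax : R) :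
  standing D S tmin tmax -> standing D' S' tmin tmax' -> kmin < kmax ->
  (forall k : R, kmin < k < kmax ->
     farfield D S tmin tmax xh k = farfield D' S' tmin tmax' xh k) ->
  ubound (arrival D xh tmin tmax) `<=` ubound (arrival D' xh tmin tmax') /\
  lbound (arrival D xh tmin tmax) `<=` lbound (arrival D' xh tmin tmax').
Proof.
move=> st st' kk H.
have [M M0 EM] := arrival_bounded xh st.
have [M' M'0 EM'] := arrival_bounded xh st'.
have E0 := arrival_neq0 xh st.
have Hk k kk := farfield_inj (H k kk).
move: (standing_pf xh st) (standing_pf xh st') Hk.
set L := retarded_total mu D (dot xh) S tmin tmax.
set L' := retarded_total mu D' (dot xh) S' tmin tmax'.
move: L L' => L L' LE LE' Hk.
(* [M + M'] bounds both arrival sets at once. *)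
apply: (pf_bounds_transfer (M := M + M') LE LE' E0 _ _ kk).
- by move=> s /EM h; rewrite (le_trans h)// lerDl.
- by move=> s /EM' h; rewrite (le_trans h)// lerDr.
- by move=> k; exact: Hk.
Qed.

(** The earliest arrivals have [t = tmin]. As [tmin] is common to both sources, lower bounds of
    arrivals determine the upper bounds of [xh.D]. *)
Lemma lbound_arrival D xh (tmin tmax u : R) : tmin <= tmax ->
  lbound (arrival D xh tmin tmax) (tmin - u) <-> ubound [set dot xh z | z in D] u.
Proof.
move=> tt; split=> [h _ [z Dz <-]|h _ [t [z [/andP[t1 _] Dz ->]]]].
  by rewrite -lerN2 -(lerD2l tmin); apply: h; exists tmin, z; rewrite lexx.
by rewrite lerB//; apply: h; exists z.
Qed.

(** The latest arrivals have [t = tmax], so this side couples [tmax] with the lower end of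
    [xh.D]. *)
Lemma ubound_arrival D xh (tmin tmax u : R) : tmin <= tmax ->
  ubound (arrival D xh tmin tmax) (tmax - u) <-> lbound [set dot xh z | z in D] u.
Proof.
move=> tt; split=> [h _ [z Dz <-]|h _ [t [z [/andP[_ t2] Dz ->]]]].
  by rewrite -lerN2 -(lerD2l tmax); apply: h; exists tmax, z; rewrite lexx andbT.
by rewrite lerB//; apply: h; exists z.
Qed.

Lemma ubound_dot_vopp D xh (u : R) :
  ubound [set dot (vopp xh) z | z in D] (- u) <-> lbound [set dot xh z | z in D] u.
Proof.
split=> h _ [z Dz <-].
  by rewrite -lerN2 -dot_vopp; apply: h; exists z.
by rewrite dot_vopp lerN2; apply: h; exists z.
Qed.

End farfield.

(** * Suprema and infima determined by the sets of bounds *)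

Section hulls.
Variable R : realType.
Implicit Types A B : set R.

Lemma eq_ubound_sup A B : A !=set0 -> has_ubound A -> ubound A = ubound B ->
  B !=set0 -> sup A = sup B.
Proof.
move=> A0 uA AB B0; have uB : has_ubound B by rewrite /has_ubound -AB.
apply/le_anti/andP; split; apply: ge_sup => //.
  by rewrite AB; exact: ub_le_sup.
by rewrite -AB; exact: ub_le_sup.
Qed.

Lemma eq_lbound_inf A B : A !=set0 -> has_lbound A -> lbound A = lbound B ->
  B !=set0 -> inf A = inf B.
Proof.
move=> A0 lA AB B0; have lB : has_lbound B by rewrite /has_lbound -AB.
apply/le_anti/andP; split; apply: lb_le_inf => //.
  by rewrite -AB; exact: ge_inf.
by rewrite AB; exact: ge_inf.
Qed.

End hulls.

Theorem theorem3p1 (R : realType) (D D' : set (R * R * R))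
    (S S' : R * R * R -> R -> R) (tmin tmax tmax' : R)
    (xh : R * R * R) (kmin kmax : R) :
  standing D S tmin tmax ->
  standing D' S' tmin tmax' ->
  on_sphere2 xh ->
  0 <= kmin -> kmin < kmax ->
  (forall k : R, kmin < k < kmax ->
     farfield D S tmin tmax xh k = farfield D' S' tmin tmax' xh k /\
     farfield D S tmin tmax (vopp xh) k = farfield D' S' tmin tmax' (vopp xh) k) ->
  Kslab D xh = Kslab D' xh /\ tmax = tmax'.
Proof.
move=> st st' _ _ kk H.
have tt : tmin <= tmax by have [_ [_ [_ [_ [_ [_ [[_ /ltW]]]]]]]] := st.
have tt' : tmin <= tmax' by have [_ [_ [_ [_ [_ [_ [[_ /ltW]]]]]]]] := st'.
have Hp k kI := (H k kI).1; have Hm k kI := (H k kI).2.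
have Hp' k kI := esym (Hp k kI); have Hm' k kI := esym (Hm k kI).
have [up lp] := arrival_bounds st st' kk Hp.
have [up' lp'] := arrival_bounds st' st kk Hp'.
have [_ lm] := arrival_bounds st st' kk Hm.
have [_ lm'] := arrival_bounds st' st kk Hm'.
pose A := [set dot xh z | z in D]; pose A' := [set dot xh z | z in D'].
have uAA' : ubound A = ubound A'.
  apply/seteqP; split=> u.
    by move/(lbound_arrival D xh u tt)/lp/(lbound_arrival D' xh u tt').
  by move/(lbound_arrival D' xh u tt')/lp'/(lbound_arrival D xh u tt).
(* The direction [-xh] exchanges upper and lower bounds of the projection, so the earliest arrivals
   there give the lower end without involving [tmax]. *)
have lAA' : lbound A = lbound A'.
  apply/seteqP; split=> u /ubound_dot_vopp h; apply/ubound_dot_vopp; move: h.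
    by move/(lbound_arrival D _ _ tt)/lm/(lbound_arrival D' _ _ tt').
  by move/(lbound_arrival D' _ _ tt')/lm'/(lbound_arrival D _ _ tt).
have [[y Dy] [_ [_ [bD _]]]] := st; have [[y' Dy'] _] := st'.
have [B _ DB] := bounded3_dot xh bD.
have A0 : A !=set0 by exists (dot xh y), y.
have A'0 : A' !=set0 by exists (dot xh y'), y'.
have uA : has_ubound A.
  by exists B => _ [z Dz <-]; rewrite (le_trans (ler_norm _)) ?DB.
have lA : has_lbound A.
  exists (- B) => _ [z Dz <-]; have := DB _ Dz.
  by rewrite ler_norml => /andP[].
have infE := eq_lbound_inf A0 lA lAA' A'0.
split; first by rewrite /Kslab (eq_ubound_sup A0 uA uAA' A'0) infE.
have lA' : has_lbound A' by rewrite /has_lbound -lAA'.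
have infA : lbound A (inf A) by exact: ge_inf.
have infA' : lbound A' (inf A) by rewrite -lAA'.
apply/le_anti/andP; split.
  move/(ubound_arrival D' xh (inf A) tt')/up' : (infA').
  (* In this form the transferred upper bound says that [tmax - tmax' + inf A] is a lower bound of
     [A]; it cannot exceed [inf A], hence [tmax <= tmax']. The other inequality is symmetric. *)
  rewrite (_ : tmax' - inf A = tmax - (tmax - tmax' + inf A)); last by ring.
  move/(ubound_arrival D xh _ tt)/(lb_le_inf A0).
  by rewrite -lerBrDr subrr subr_le0.
move/(ubound_arrival D xh (inf A) tt)/up : (infA).
rewrite (_ : tmax - inf A = tmax' - (tmax' - tmax + inf A)); last by ring.
move/(ubound_arrival D' xh _ tt')/(lb_le_inf A'0).
by rewrite -infE -lerBrDr subrr subr_le0.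
Qed.
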